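(* Let $n\ge2$, $\Omega=\mathbb{R}^n$, $T>0$ and $\Omega_T=\mathbb{R}^n\times(0,T)$. Suppose that $\phi\in C(\Omega_T\cup(\Omega\times\{0\}))$, $\phi>0$, solves in the viscosity sense $$\Delta_\infty\phi=3\phi^2\phi_t\ \text{ in }\Omega_T,\qquad \phi(x,0)=f(x)\ \text{ for all }x\in\Omega,$$ where $f:\Omega\to(0,\infty)$ is continuous and bounded. If $\phi$ is bounded, then $$\inf_\Omega f\le\phi(x,t)\le\sup_\Omega f\qquad\text{for all }(x,t)\in\Omega_T .$$
   Context: $\Delta_\infty\phi=\sum_{i,j}\phi_{x_i}\phi_{x_j}\phi_{x_ix_j}$. $\mathcal S(n)$ is the set of symmetric $n\times n$ real matrices. Semi-jets: for $(y,s)\in\Omega_T$, $(a,p,X)\in\mathbb{R}\times\mathbb{R}^n\times\mathcal S(n)$ belongs to $\mathcal P^+_{\Omega_T}u(y,s)$ if $u(x,t)\le u(y,s)+a(t-s)+\langle p,x-y\rangle+\tfrac12\langle X(x-y),x-y\rangle+o(|t-s|+|x-y|^2)$ as $(x,t)\to(y,s)$ in $\Omega_T$; $\mathcal P^-_{\Omega_T}u=-\mathcal P^+_{\Omega_T}(-u)$. $\Delta_\infty\phi=3\phi^2\phi_t$ in $\Omega_T$ means: $\phi$ is continuous in $\Omega_T$ and, for all $(y,s)\in\Omega_T$, $\langle Xp,p\rangle-3a\,\phi(y,s)^2\ge0$ for all $(a,p,X)\in\mathcal P^+_{\Omega_T}\phi(y,s)$, and $\langle Yq,q\rangle-3b\,\phi(y,s)^2\le0$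 for all $(b,q,Y)\in\mathcal P^-_{\Omega_T}\phi(y,s)$. *)

(* Defs.v *)
From HB Require Import structures.
From mathcomp Require Import all_boot all_order all_algebra.
From mathcomp Require Import all_classical all_reals all_analysis.
Set Implicit Arguments.
Unset Strict Implicit.
Unset Printing Implicit Defensive.
Import Order.TTheory GRing.Theory Num.Theory.
Import numFieldNormedType.Exports.
Local Open Scope classical_set_scope.
Local Open Scope ring_scope.

(* The library norm on matrices is the sup norm, hence an explicit Euclidean
   structure on column vectors. *)
Definition dotv (R : realType) (n : nat) (u v : 'cV[R]_n) : R :=
  \sum_(i < n) u i ord0 * v i ord0.

Definition normv (R : realType) (n : nat) (u : 'cV[R]_n) : R :=
  Num.sqrt (dotv u u).

Definition cylinder (R : realType) (n : nat) (Omega : set 'cV[R]_n) (T : R)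
  : set ('cV[R]_n * R) := Omega `*` `]0, T[.

Definition initial_slice (R : realType) (n : nat) (Omega : set 'cV[R]_n)
  : set ('cV[R]_n * R) := Omega `*` [set 0].

Definition superjet (R : realType) (n : nat) (D : set ('cV[R]_n * R))
    (u : 'cV[R]_n * R -> R) (y : 'cV[R]_n) (s : R)
    : set (R * 'cV[R]_n * 'M[R]_n) :=
  [set j | let: (a, p, X) := j in
    X^T = X /\
    exists h : {o_(within D (nbhs (y, s)))
        (fun z : 'cV[R]_n * R => `|z.2 - s| + normv (z.1 - y) ^+ 2)},
      \forall z \near within D (nbhs (y, s)),
        u z <= u (y, s) + a * (z.2 - s) + dotv p (z.1 - y)
               + 2^-1 * dotv (X *m (z.1 - y)) (z.1 - y) + h z].

Definition subjet (R : realType) (n : nat) (D : set ('cV[R]_n * R))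
    (u : 'cV[R]_n * R -> R) (y : 'cV[R]_n) (s : R)
    : set (R * 'cV[R]_n * 'M[R]_n) :=
  [set j | let: (a, p, X) := j in
    superjet D (fun z => - u z) y s (- a, - p, - X)].

(* Viscosity solutions of Delta_infty phi = 3 phi^2 phi_t in D; only the values
   of phi on D matter. *)
Definition viscosity_solution (R : realType) (n : nat)
    (D : set ('cV[R]_n * R)) (phi : 'cV[R]_n * R -> R) : Prop :=
  {within D, continuous phi} /\
  forall (y : 'cV[R]_n) (s : R), D (y, s) ->
    (forall (a : R) (p : 'cV[R]_n) (X : 'M[R]_n),
       superjet D phi y s (a, p, X) ->
       0 <= dotv (X *m p) p - 3 * a * phi (y, s) ^+ 2) /\
    (forall (b : R) (q : 'cV[R]_n) (Y : 'M[R]_n),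
       subjet D phi y s (b, q, Y) ->
       dotv (Y *m q) q - 3 * b * phi (y, s) ^+ 2 <= 0).

(* Main.v *)
Require Import Defs.
From HB Require Import structures.
From mathcomp Require Import all_boot all_order all_algebra.
From mathcomp Require Import all_classical all_reals all_analysis.
From mathcomp Require Import ring lra.

(**
Both bounds follow from the maximum principle for viscosity solutions: compare
phi with an explicit smooth barrier, take the point where the two are closest,
and test the equation there with the jet of the barrier.  The domain is
unbounded and its terminal time is open, so the barrier must force this point
to exist and to lie strictly between time 0 and time T.  A function of time c
with derivative at least lam (terminal_clock) is used in both cases: it is
small at the time under study and as large as needed before T.

Upper bound (max_principle).  If phi exceeds m = sup f somewhere, then
phi - e |x|^2 - c(t) has a maximum at some (y, s) with 0 < s < T, the quadratic
term being coercive because phi <= M.  The barrier has slope p = 2 e y and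
Hessian X = 2 e I, so <X p, p> = 8 e^3 |y|^2; since e |y|^2 <= M at the
maximum, this is at most 8 e^2 M.  The term 3 c'(s) phi^2 is at least
3 lam m^2, and the equation fails once e is small compared with lam.

Lower bound (min_principle).  Let m = inf f.  The additive argument breaks down
here: phi may approach 0 at infinity, where the coefficient phi^2 of the time
derivative degenerates.  Instead, phi is compared with multiples of
  u(x,t) = (1 - e |x|^2)^2 (1 - c(t)),
which vanishes on the boundary of a ball of radius e^(-1/2).  If phi < m
at some point, then u / phi exceeds 1/m there for small e, whereas u / phi is
at most 1/m at time 0 and at most 0 on the rest of the boundary.  As phi is
bounded away from 0 on compact sets, u / phi thus has a maximum at an interior
point, and there a multiple of u touches phi from below.  The
equation is homogeneous of degree 3, so the multiple is irrelevant, and it only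
remains to see that u is a strict subsolution (separated_subsolution).  The
square makes Delta_infty u nonnegative near the boundary of the ball; near its
centre the decay rate lam = 10 e^2 compensates.  Since this rate tends to 0
with e, so does the loss 1 - u at the given point.
*)

Set Implicit Arguments.
Unset Strict Implicit.
Unset Printing Implicit Defensive.
Import Order.TTheory GRing.Theory Num.Theory.
Import numFieldNormedType.Exports.
Local Open Scope classical_set_scope.
Local Open Scope ring_scope.

(** * The Euclidean structure on column vectors *)

Section Euclidean.
Context {R : realType} {n : nat}.
Implicit Types (u v w x y : 'cV[R]_n) (k : R).

Lemma dotvC u v : dotv u v = dotv v u.
Proof. by apply: eq_bigr => i _; rewrite mulrC. Qed.

Lemma dotvDl u v w : dotv (u + v) w = dotv u w + dotv v w.
Proof. by rewrite -big_split; apply: eq_bigr => i _; rewrite mxE mulrDl. Qed.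

Lemma dotvZl k u v : dotv (k *: u) v = k * dotv u v.
Proof. by rewrite mulr_sumr; apply: eq_bigr => i _; rewrite mxE mulrA. Qed.

Lemma dotvNl u v : dotv (- u) v = - dotv u v.
Proof. by rewrite -scaleN1r dotvZl mulN1r. Qed.

Lemma dotvZr k u v : dotv u (k *: v) = k * dotv u v.
Proof. by rewrite dotvC dotvZl dotvC. Qed.

Lemma dotvv_ge0 u : 0 <= dotv u u.
Proof. by apply: sumr_ge0 => i _; rewrite -expr2 sqr_ge0. Qed.

Lemma dotvv_sub x y :
  dotv x x = dotv y y + 2 * dotv y (x - y) + dotv (x - y) (x - y).
Proof.
have e u v : dotv (u + v) (u + v) = dotv u u + 2 * dotv u v + dotv v v.
  by rewrite dotvDl ![dotv _ (u + v)]dotvC !dotvDl (dotvC v u); ring.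
by rewrite -e subrKC.
Qed.

Lemma normv_sqr u : normv u ^+ 2 = dotv u u.
Proof. by rewrite sqr_sqrtr // dotvv_ge0. Qed.

Lemma mulmx_outer y v : y *m y^T *m v = dotv y v *: y.
Proof.
apply/colP => i; rewrite -mulmxA [LHS]mxE big_ord1 [RHS]mxE mulrC.
by congr (_ * _); rewrite mxE; apply: eq_bigr => k _; rewrite mxE.
Qed.

Lemma sqr_coord_le u i : u i ord0 ^+ 2 <= dotv u u.
Proof.
rewrite /dotv (bigD1 i) //= -expr2 lerDl.
by apply: sumr_ge0 => j _; rewrite -expr2 sqr_ge0.
Qed.

Lemma cvg_dotv (S : Type) (F : set_system S) {FF : Filter F}
    (f g : S -> 'cV[R]_n) u v :
  f z @[z --> F] --> u -> g z @[z --> F] --> v ->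
  dotv (f z) (g z) @[z --> F] --> dotv u v.
Proof.
move=> fu gv; apply: cvg_big => [|i _]; first exact: add_continuous.
have coord h w : h z @[z --> F] --> w -> h z i ord0 @[z --> F] --> w i ord0.
  move=> hw; apply: (cvg_comp h (fun M : 'cV[R]_n => M i ord0) hw).
  exact: coord_continuous.
by apply: cvgM; apply: coord.
Qed.

(** Transposition carries the Heine-Borel theorem from row vectors to columns. *)
Lemma compact_ball_dotv (r : R) : compact [set u : 'cV[R]_n | dotv u u <= r].
Proof.
have tr_cont : continuous (fun v : 'rV[R]_n => v^T).
  move=> v B /nbhs_ballP[e e0 eB]; apply/nbhs_ballP; exists e => // w [_ vw].
  by apply: eB; split=> // i j; rewrite !mxE; apply: vw.
have -> : [set u : 'cV[R]_n | dotv u u <= r] =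
    trmx @` [set v : 'rV[R]_n | dotv v^T v^T <= r].
  apply/seteqP; split => [u ur|_ [v vr <-]] //.
  by exists u^T => //=; rewrite trmxK.
apply: continuous_compact; first exact: continuous_subspaceT.
apply: bounded_closed_compact.
- exists (1 + `|r|); split; first exact: num_real.
  move=> M rM v /= vr; rewrite [leLHS]/Num.norm /= mx_normrE.
  apply/bigmax_leP; split=> [|[i j] _ /=]; first by have := normr_ge0 r; lra.
  rewrite ord1 -ler_sqr ?nnegrE ?real_normK ?num_real //; last first.
    by have := normr_ge0 r; lra.
  have := sqr_coord_le v^T j; rewrite mxE => h.
  by have := ler_norm r; have := normr_ge0 r; nra.
- apply: (@closed_comp _ _ (fun v : 'rV[R]_n => dotv v^T v^T) [set x | x <= r]).
    move=> v _; apply: (cvg_dotv (F := nbhs v) (f := trmx) (g := trmx));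
      exact: tr_cont.
  exact: closed_le.
Qed.

End Euclidean.

(** * Jets of touching functions *)

Section Touching.
Context {R : realType} {n : nat}.

(** A remainder eta1 (t - s) + eta2 |x - y|^2 whose coefficients vanish at
(y, s) is o(|t - s| + |x - y|^2).  Taylor remainders of polynomial barriers
are given in this form, so that checking them is a matter of continuity. *)
Lemma superjet_touching (D : set ('cV[R]_n * R)) (u eta1 eta2 : 'cV[R]_n * R -> R)
    (y : 'cV[R]_n) (s a : R) (p : 'cV[R]_n) (X : 'M[R]_n) :
  X^T = X ->
  eta1 z @[z --> (y, s)] --> 0 -> eta2 z @[z --> (y, s)] --> 0 ->
  (\forall z \near (y, s), D z ->
     u z <= u (y, s) + a * (z.2 - s) + dotv p (z.1 - y)
            + 2^-1 * dotv (X *m (z.1 - y)) (z.1 - y)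
            + (eta1 z * (z.2 - s) + eta2 z * dotv (z.1 - y) (z.1 - y))) ->
  superjet D u y s (a, p, X).
Proof.
move=> XT e1 e2 near_le; split=> //.
pose h (z : 'cV[R]_n * R) :=
  eta1 z * (z.2 - s) + eta2 z * dotv (z.1 - y) (z.1 - y).
have ho : `[< forall e : R, 0 < e -> \forall z \near within D (nbhs (y, s)),
    `|h z| <= e * `| `|z.2 - s| + normv (z.1 - y) ^+ 2| >].
  apply/asboolP => e e0; apply: cvg_within.
  have /cvgr0_norm_le/(_ _ e0) h1 := e1.
  have /cvgr0_norm_le/(_ _ e0) h2 := e2.
  near=> z.
  have n0 := dotvv_ge0 (z.1 - y).
  rewrite normv_sqr [X in _ <= _ * X]ger0_norm ?addr_ge0 // mulrDr.
  rewrite (le_trans (ler_normD _ _)) // lerD // normrM.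
    by rewrite ler_wpM2r //; near: z.
  by rewrite [X in _ * X]ger0_norm // ler_wpM2r //; near: z.
exists (Littleo ho).
by apply: filterS near_le => z.
Unshelve. all: by end_near. Qed.

End Touching.

(** * Barriers in time *)

(** The witness is lam t + K max(0, t - t0)^2, with K so large that it is at least
L from the midpoint t1 of [t0, T] on.  Being only C^1 is enough, because jets
are of first order in time and touching uses a one-sided Taylor bound.  The bound by L excludes touching points at
or after t1, so that no maximum escapes to the open end T. *)
Lemma terminal_clock {R : realType} (lam t0 T L : R) :
  0 < lam -> 0 < t0 < T ->
  exists (t1 K : R) (c c' : R -> R),
    [/\ t0 < t1 < T, continuous c, c 0 = 0 /\ c t0 = lam * t0,
        forall t, t1 <= t -> L <= c t &
        [/\ forall t, 0 <= t -> 0 <= c t, forall t, lam <= c' t &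
         forall s t, c t <= c s + c' s * (t - s) + K * (t - s) ^+ 2]].
Proof.
move=> lam0 /andP[t00 t0T].
pose k t : R := Num.max 0 (t - t0).
have kc : continuous k.
  move=> t; apply: (@continuous_max R R (fun=> 0) (fun t => t - t0)).
    exact: cvg_cst.
  by apply: cvgB; [exact: cvg_id|exact: cvg_cst].
have k0 t : 0 <= k t by rewrite /k le_max lexx.
pose t1 := (t0 + T) / 2.
have d0 : 0 < t1 - t0 by rewrite /t1; lra.
pose K := `|L| / (t1 - t0) ^+ 2.
have K0 : 0 <= K by rewrite divr_ge0 // sqr_ge0.
exists t1, K, (fun t => lam * t + K * k t ^+ 2), (fun t => lam + 2 * K * k t).
split.
- by rewrite /t1; lra.
- move=> t; apply: cvgD; apply: cvgM; do ?exact: cvg_cst; first exact: cvg_id.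
  by apply: cvgM; apply: kc.
- by rewrite /k subrr maxxx max_l; [split; ring|lra].
- move=> t t1t; have kt : t1 - t0 <= k t by rewrite /k le_max; lra.
  have -> : L = L / (t1 - t0) ^+ 2 * (t1 - t0) ^+ 2.
    by rewrite divfK // gt_eqF // exprn_gt0.
  have h1 : L / (t1 - t0) ^+ 2 <= K.
    by rewrite ler_pM2r ?invr_gt0 ?exprn_gt0 // ler_norm.
  have h2 : (t1 - t0) ^+ 2 <= k t ^+ 2 by rewrite ler_sqr ?nnegrE // ltW.
  have h3 : 0 <= (t1 - t0) ^+ 2 by rewrite sqr_ge0.
  have : L / (t1 - t0) ^+ 2 * (t1 - t0) ^+ 2 <= K * k t ^+ 2.
    by rewrite (le_trans (ler_wpM2r h3 h1)) // ler_wpM2l.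
  have : 0 <= lam * t by rewrite mulr_ge0 // ?ltW //; lra.
  lra.
split=> [t tge|t|s t].
- by apply: addr_ge0; apply: mulr_ge0 => //; [exact: ltW|exact: sqr_ge0].
- by rewrite lerDl; apply: mulr_ge0 => //; apply: mulr_ge0.
- have : k t ^+ 2 <= k s ^+ 2 + 2 * k s * (t - s) + (t - s) ^+ 2.
    have -> : t - s = (t - t0) - (s - t0) by ring.
    rewrite /k; move: (t - t0) (s - t0) => a b; have := sqr_ge0 (a - b).
    by case: (leP 0 a) => ha; case: (leP 0 b) => hb; nra.
  by move=> /(ler_wpM2l K0); lra.
Qed.

(** * Comparison with barriers *)

Section MaximumPrinciple.
Context {R : realType} {n : nat}.

Lemma continuous_sqnorm_fst :
  continuous (fun z : 'cV[R]_n * R => dotv z.1 z.1).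
Proof.
by move=> [x t]; apply: (cvg_dotv (F := nbhs (x, t)) (f := fst) (g := fst));
  exact: cvg_fst.
Qed.

Lemma continuous_comp_snd (c : R -> R) :
  continuous c -> continuous (fun z : 'cV[R]_n * R => c z.2).
Proof.
by move=> cc z; apply: (continuous_comp (f := snd)); [exact: cvg_snd|exact: cc].
Qed.

Context {T : R}.
Let Q : set ('cV[R]_n * R) := cylinder setT T `|` initial_slice setT.

Lemma closed_cylinder_in (x : 'cV[R]_n) (t : R) : 0 <= t < T -> Q (x, t).
Proof.
rewrite le_eqVlt => /andP[/predU1P[<-|t0] tT]; first by right.
by left; split=> //=; rewrite in_itv /= t0.
Qed.

Lemma max_ball_cylinder (r t1 : R) (w : 'cV[R]_n * R -> R) (x0 : 'cV[R]_n) (t0 : R) :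
  t1 < T -> {within Q, continuous w} -> dotv x0 x0 <= r -> 0 <= t0 <= t1 ->
  exists (y : 'cV[R]_n) (s : R), [/\ dotv y y <= r, 0 <= s <= t1 &
    forall x t, dotv x x <= r -> 0 <= t <= t1 -> w (x, t) <= w (y, s)].
Proof.
move=> t1T wc x0r t0t1.
pose S := [set x : 'cV[R]_n | dotv x x <= r] `*` `[0, t1]%classic.
have SQ : S `<=` Q.
  move=> [x t] [_ /=]; rewrite in_itv /= => /andP[tge tle].
  by apply: closed_cylinder_in; rewrite tge (le_lt_trans tle).
have S0 : S !=set0 by exists (x0, t0); split=> //=; rewrite in_itv.
have cS : compact S.
  by apply: compact_setX; [exact: compact_ball_dotv|exact: segment_compact].
have [[y s] /set_mem[/= yr]] :=
  compact_EVT_max S0 cS (continuous_subspaceW SQ wc).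
rewrite in_itv /= => sI ymax; exists y, s; split=> // x t xr tI.
by apply: ymax; apply/mem_set; split=> //=; rewrite in_itv.
Qed.

(** The strict inequality m < phi at the maximum keeps the coefficient phi^2 of
the time derivative away from 0, so that the slope lam of the penalty c gives
the equation a strict sign. *)
Lemma max_principle (phi : 'cV[R]_n * R -> R) (m M : R) :
  {within Q, continuous phi} -> viscosity_solution (cylinder setT T) phi ->
  0 < m -> (forall z, Q z -> phi z <= M) -> (forall x, phi (x, 0) <= m) ->
  forall x t, cylinder setT T (x, t) -> phi (x, t) <= m.
Proof.
move=> phic [_ sol] m0 phiM phi0 x0 t0 [_ /=]; rewrite in_itv /= => t0T.
rewrite leNgt; apply/negP => mphi.
have [t00 t0T'] := andP t0T.
have mM : phi (x0, t0) <= M.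
  by apply: phiM; apply: closed_cylinder_in; rewrite ltW.
pose d := phi (x0, t0) - m.
have d0 : 0 < d by rewrite subr_gt0.
pose lam := d / (4 * t0).
have lam0 : 0 < lam by rewrite divr_gt0 // mulr_gt0.
have lamt : lam * t0 = d / 4 by rewrite /lam; field; rewrite gt_eqF.
pose N := dotv x0 x0.
have N0 : 0 <= N := dotvv_ge0 x0.
(* The bound on e N keeps phi minus the penalties above m at (x0, t0); the last
   one, with e <= 1, makes the equation fail at the maximum. *)
have [e [e0 e1 eN eM]] : exists e : R,
    [/\ 0 < e, e <= 1, e * N < d / 4 & 8 * e * M < 3 * lam * m ^+ 2].
  pose B := 1 + N / (d / 4) + 8 * M / (3 * lam * m ^+ 2).
  have d40 : 0 < d / 4 by rewrite divr_gt0.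
  have lm0 : 0 < 3 * lam * m ^+ 2.
    by apply: mulr_gt0; [exact: mulr_gt0|exact: exprn_gt0].
  have M0 : 0 < M by lra.
  have h1 : 0 <= N / (d / 4) by rewrite divr_ge0 // ltW.
  have h2 : 0 <= 8 * M / (3 * lam * m ^+ 2).
    by apply: divr_ge0; [apply: mulr_ge0 => //|]; exact: ltW.
  have B0 : 0 < B by rewrite /B; lra.
  exists B^-1; split; rewrite ?invr_gt0 //.
  - by rewrite invf_le1 // /B; lra.
  - by rewrite mulrC ltr_pdivrMr // -ltr_pdivrMl // mulrC /B; lra.
  - by rewrite mulrAC ltr_pdivrMr // -ltr_pdivrMl // mulrC /B; lra.
have [t1 [K [c [c' [/andP[t01 t1T] cc [c0 ct0] cL [cge c'ge ctay]]]]]] :=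
  terminal_clock M lam0 t0T.
pose w (z : 'cV[R]_n * R) := phi z - (e * dotv z.1 z.1 + c z.2).
have wc : {within Q, continuous w}.
  have pc : continuous (fun z : 'cV[R]_n * R => e * dotv z.1 z.1 + c z.2).
    move=> z; apply: cvgD; last exact: continuous_comp_snd.
    by apply: cvgM; [exact: cvg_cst|exact: continuous_sqnorm_fst].
  by move=> z; apply: cvgB; [exact: phic|exact: (continuous_subspaceT pc)].
have M0 : 0 < M by lra.
have x0r : dotv x0 x0 <= M / e.
  by rewrite ler_pdivlMr // mulrC (le_trans (ltW eN)) // /d; lra.
have t0I : 0 <= t0 <= t1 by rewrite !ltW.
have [y [s [yr /andP[s0 s1] wmax]]] := max_ball_cylinder t1T wc x0r t0I.
have wm : m < w (y, s).
  apply: lt_le_trans (wmax _ _ x0r t0I).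
  by rewrite /w /= ct0 lamt -/N; move: eN; rewrite /d; lra.
have eN' : 0 <= e * dotv y y by rewrite mulr_ge0 ?dotvv_ge0 // ltW.
have Qys : Q (y, s) by apply: closed_cylinder_in; rewrite s0 (le_lt_trans s1).
have cs0 := cge _ s0.
have phim : m < phi (y, s) by move: wm; rewrite /w /=; lra.
have sgt : 0 < s.
  rewrite lt_neqAle s0 andbT; apply/eqP => s_eq.
  by have := phi0 y; move: phim; rewrite -s_eq; lra.
(* Outside the compact set w <= 0 < m < w (y, s): the clock is at least M for
   late times, and e |x|^2 exceeds M far away. *)
have late z : Q z -> t1 <= z.2 -> w z <= w (y, s).
  move=> Qz /cL h; have := phiM z Qz; rewrite {1}/w.
  have : 0 <= e * dotv z.1 z.1 by rewrite mulr_ge0 ?dotvv_ge0 // ltW.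
  lra.
have far z : Q z -> 0 <= z.2 -> M / e < dotv z.1 z.1 -> w z <= w (y, s).
  move=> Qz /cge h; rewrite ltr_pdivrMr // mulrC => far.
  by have := phiM z Qz; rewrite {1}/w; lra.
have wglob z : cylinder setT T z -> w z <= w (y, s).
  case: z => x t cyl; have [_ /=] := cyl; rewrite in_itv /= => /andP[tg tT].
  have [xr|xr] := leP (dotv x x) (M / e); last by apply: far => //=; [left|lra].
  have [tt|tt] := leP t t1; last by apply: late => /=; [left|lra].
  by apply: wmax => //; rewrite tt ltW.
have Dys : cylinder setT T (y, s).
  by split=> //=; rewrite in_itv /= sgt (le_lt_trans s1).
have jet : superjet (cylinder setT T) phi y s
    (c' s, (2 * e) *: y, (2 * e)%:M).
  apply: (@superjet_touching _ _ _ _ (fun z => K * (z.2 - s)) (fun=> 0)).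
  - by rewrite tr_scalar_mx.
  - rewrite -[X in _ --> X](mulr0 K) -(subrr s).
    apply: cvgM; first exact: cvg_cst.
    by apply: cvgB; [exact: cvg_snd|exact: cvg_cst].
  - exact: cvg_cst.
  - near=> z => /wglob; rewrite /w /=.
    rewrite (dotvv_sub z.1 y) mul_scalar_mx !dotvZl.
    have := ctay s z.2; lra.
have [/(_ _ _ _ jet) + _] := sol y s Dys.
rewrite mul_scalar_mx !(dotvZl, dotvZr).
have := c'ge s; move: yr; rewrite ler_pdivlMr //.
have p2 : m ^+ 2 < phi (y, s) ^+ 2 by rewrite ltr_sqr ?nnegrE //; lra.
move=> yr c's.
have : lam * m ^+ 2 <= c' s * phi (y, s) ^+ 2.
  by apply: ler_pM => //; [exact: ltW|exact: sqr_ge0|exact: ltW].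
have : e ^+ 2 * (dotv y y * e) <= e * M.
  rewrite ler_pM ?sqr_ge0 //; first by rewrite mulrC.
  by rewrite expr2 ger_pMl.
lra.
Unshelve. all: by end_near. Qed.

(** Up to the positive factor sigma^2 (1 - rho)^2, this is Delta_infty u - 3 u^2 u_t
for u = (1 - e |x|^2)^2 sigma(t), with rho = e |x|^2 and alpha = - sigma'.  The
first summand is negative only for rho < 1/3; there rho (1 - 3 rho) <= 1/12
and (1 - rho)^4 >= 16/81, and 64/12 e^2 < 3 (16/81) lam holds when
lam > 9 e^2. *)
Lemma separated_subsolution (e lam alpha sigma rho : R) :
  0 < e -> 9 * e ^+ 2 < lam -> lam <= alpha -> 0 < sigma <= 1 -> 0 <= rho < 1 ->
  0 < 64 * e ^+ 2 * sigma * rho * (3 * rho - 1) + 3 * alpha * (1 - rho) ^+ 4.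
Proof.
move=> e0 elam lama /andP[s0 s1] /andP[r0 r1].
have e20 : 0 < e ^+ 2 by rewrite exprn_gt0.
have [hr|hr] := leP 1 (3 * rho).
  apply: ltr_wpDl; first by rewrite !mulr_ge0 ?subr_ge0 // ltW.
  by rewrite !mulr_gt0 ?exprn_gt0 ?subr_gt0 //; lra.
have q : rho * (1 - 3 * rho) <= 12^-1.
  by have := sqr_ge0 (6 * rho - 1); rewrite expr2; lra.
have q0 : 0 <= rho * (1 - 3 * rho) by rewrite mulr_ge0 //; lra.
have h1 : e ^+ 2 * sigma * (rho * (1 - 3 * rho)) <= e ^+ 2 * 12^-1.
  rewrite ler_pM //; first by rewrite mulr_ge0 ?ltW.
  by rewrite ger_pMr.
have h2 : (2 / 3) ^+ 4 <= (1 - rho) ^+ 4.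
  by rewrite ler_pXn2r ?nnegrE //; lra.
have h3 : lam * (2 / 3) ^+ 4 <= alpha * (1 - rho) ^+ 4.
  by apply: ler_pM => //; lra.
have h4 : (2 / 3) ^+ 4 = 16 / 81 :> R by field.
rewrite h4 in h3; lra.
Qed.

(** Homogeneity enters through the factor k, the value of phi / u at the touching
point: k u and phi agree there, so the coefficient phi^2 is (k u)^2 and the
equation is tested on k u itself. *)
Lemma min_principle (phi : 'cV[R]_n * R -> R) (m : R) :
  {within Q, continuous phi} -> viscosity_solution (cylinder setT T) phi ->
  (forall z, Q z -> 0 < phi z) -> (forall x, m <= phi (x, 0)) ->
  forall x t, cylinder setT T (x, t) -> m <= phi (x, t).
Proof.
move=> phic [_ sol] phi_gt0 phi0 x0 t0 [_ /=]; rewrite in_itv /= => t0T.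
rewrite leNgt; apply/negP => mphi.
have [t00 t0T'] := andP t0T.
have p0 : 0 < phi (x0, t0).
  by apply: phi_gt0; apply: closed_cylinder_in; rewrite ltW.
have m0 : 0 < m by lra.
pose N := dotv x0 x0.
have N0 : 0 <= N := dotvv_ge0 x0.
pose d := 1 - phi (x0, t0) / m.
have d0 : 0 < d by rewrite subr_gt0 ltr_pdivrMr // mul1r.
have d1 : d < 1 by rewrite gtrBl divr_gt0.
(* The last bound yields u > phi / m at (x0, t0), since
   (1 - e N)^2 (1 - 10 e^2 t0) >= 1 - e (2 N + 10 t0). *)
have [e [e0 e1 ed]] : exists e : R,
    [/\ 0 < e, e <= 1 & e * (2 * N + 10 * t0) < d].
  exists (d / (1 + (2 * N + 10 * t0))).
  have B0 : 0 < 1 + (2 * N + 10 * t0) by lra.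
  split; first by rewrite divr_gt0.
  - by rewrite ler_pdivrMr //; lra.
  - by rewrite mulrAC ltr_pdivrMr // ltr_pM2l //; lra.
pose lam := 10 * e ^+ 2.
have lam0 : 0 < lam by rewrite mulr_gt0 // exprn_gt0.
have [t1 [K [c [c' [/andP[t01 t1T] cc [c0 ct0] cL [cge c'ge ctay]]]]]] :=
  terminal_clock 1 lam0 t0T.
pose g (z : 'cV[R]_n * R) := 1 - e * dotv z.1 z.1.
have gc : continuous g.
  move=> z; apply: cvgB; first exact: cvg_cst.
  by apply: cvgM; [exact: cvg_cst|exact: continuous_sqnorm_fst].
pose w (z : 'cV[R]_n * R) := g z ^+ 2 * (1 - c z.2) / phi z.
have wc : {within Q, continuous w}.
  have nc : continuous (fun z => g z ^+ 2 * (1 - c z.2)).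
    move=> z; apply: cvgM; first by apply: cvgM; exact: gc.
    by apply: cvgB; [exact: cvg_cst|exact: continuous_comp_snd].
  rewrite continuous_subspace_in => z /set_mem Qz; apply: cvgM.
    exact: (continuous_subspaceT nc).
  by apply: cvgV; [rewrite gt_eqF // phi_gt0|exact: phic].
have eN : 0 <= e * N by rewrite mulr_ge0 // ltW.
have et : 0 < e * t0 by rewrite mulr_gt0.
have x0r : dotv x0 x0 <= e^-1.
  by rewrite -[e^-1]mul1r ler_pdivlMr // mulrC -/N; lra.
have t0I : 0 <= t0 <= t1 by rewrite !ltW.
have [y [s [yr /andP[s0 s1] wmax]]] := max_ball_cylinder t1T wc x0r t0I.
(* Ratios above 1/m exclude s = 0, where u <= 1 and phi >= m. *)
have wm : m^-1 < w (y, s).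
  apply: lt_le_trans (wmax _ _ x0r t0I).
  rewrite /w /g /= ct0 -/N ltr_pdivlMr // mulrC.
  have : lam * t0 <= 10 * (e * t0).
    by rewrite /lam expr2; have := ler_wpM2r (ltW et) e1; lra.
  move=> lamt; have lamt0 : 0 <= lam * t0 by rewrite mulr_ge0 // ltW.
  have := mulr_ge0 eN lamt0.
  have sq : 1 - 2 * (e * N) <= (1 - e * N) ^+ 2.
    by have := sqr_ge0 (e * N); rewrite !expr2; lra.
  have : (1 - 2 * (e * N)) * (1 - lam * t0) <=
         (1 - e * N) ^+ 2 * (1 - lam * t0).
    by apply: ler_wpM2r sq; lra.
  move: ed; rewrite /d; lra.
have eR : 0 <= e * dotv y y by rewrite mulr_ge0 ?dotvv_ge0 // ltW.
have gy0 : 0 <= g (y, s).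
  by rewrite /g /=; move: yr; rewrite -[e^-1]mul1r ler_pdivlMr //; lra.
have Qys : Q (y, s) by apply: closed_cylinder_in; rewrite s0 (le_lt_trans s1).
have cs0 := cge _ s0.
have phis := phi_gt0 _ Qys.
have w0 : 0 < w (y, s) by rewrite (lt_trans _ wm) // invr_gt0.
have num0 : 0 < g (y, s) ^+ 2 * (1 - c s).
  by move: w0; rewrite /w /= pmulr_lgt0 // invr_gt0.
have gy : 0 < g (y, s).
  rewrite lt_neqAle gy0 andbT; apply/eqP => gz.
  by move: num0; rewrite -gz expr0n mul0r ltxx.
have sig0 : 0 < 1 - c s by move: num0; rewrite pmulr_rgt0 // exprn_gt0.
have s1' : s < t1 by rewrite ltNge; apply/negP => /cL; lra.
have sgt : 0 < s.
  rewrite lt_neqAle s0 andbT; apply/eqP => s_eq.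
  move: wm phis; rewrite /w -s_eq /= c0 subr0 mulr1 => + py.
  apply/negP; rewrite -leNgt ler_pdivrMr //; apply: (@le_trans _ _ 1).
    by rewrite expr_le1 // /g /=; lra.
  by rewrite ler_pdivlMl // mulr1.
have Dys : cylinder setT T (y, s).
  by split=> //=; rewrite in_itv /= sgt (le_lt_trans s1).
pose k := phi (y, s) / (g (y, s) ^+ 2 * (1 - c s)).
have k0 : 0 < k by rewrite divr_gt0.
have wk : w (y, s) = k^-1 by rewrite /w /k invf_div.
have phiE : phi (y, s) = k * (g (y, s) ^+ 2 * (1 - c s)).
  by rewrite divfK // gt_eqF.
have sndc : (z : 'cV[R]_n * R).2 @[z --> (y, s)] --> s by exact: cvg_snd.
(* This holds only near (y, s): outside the ball, g^2 grows again. *)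
have touch : \forall z \near (y, s), cylinder setT T z ->
    k * (g z ^+ 2 * (1 - c z.2)) <= phi z.
  have g_near : \forall z \near (y, s), 0 < g z.
    exact: cvgr_gt (gc (y, s)) _ gy.
  have t_near : \forall z \near (y, s), z.2 < t1.
    exact: cvgr_lt sndc _ s1'.
  apply: filterS2 g_near t_near => -[x t] /= gx tt cyl.
  have [_ /=] := cyl; rewrite in_itv /= => /andP[tg _].
  have xr : dotv x x <= e^-1.
    by rewrite -[e^-1]mul1r ler_pdivlMr // mulrC; move: gx; rewrite /g /=; lra.
  have tI : 0 <= t <= t1 by rewrite !ltW.
  have := wmax x t xr tI.
  have px : 0 < phi (x, t) by apply: phi_gt0; left.
  by rewrite wk /w /= ler_pdivrMr // ler_pdivlMl.
pose sig := 1 - c s; pose g0 := g (y, s).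
pose Y := (k * sig) *: ((8 * e ^+ 2) *: (y *m y^T) - (4 * e * g0)%:M).
have YT : Y^T = Y.
  by rewrite /Y linearZ /= linearB /= linearZ /= trmx_mul trmxK tr_scalar_mx.
have Yv v : Y *m v =
    (k * sig) *: ((8 * e ^+ 2 * dotv y v) *: y - (4 * e * g0) *: v).
  rewrite /Y -scalemxAl mulmxBl mul_scalar_mx -scalemxAl mulmx_outer.
  by rewrite scalerA.
have jet : subjet (cylinder setT T) phi y s
    (- (k * g0 ^+ 2 * c' s), (- (4 * e * k * g0 * sig)) *: y, Y).
  rewrite /subjet /= !opprK.
  apply: (@superjet_touching _ _ _ _
    (fun z => k * ((g z ^+ 2 - g0 ^+ 2) * c' s + g z ^+ 2 * (K * (z.2 - s))))
    (fun z => - (k * sig * e ^+ 2 *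
                 (4 * dotv y (z.1 - y) + dotv (z.1 - y) (z.1 - y))))).
  - by rewrite linearN /= YT.
  - have -> : 0 = k * ((g0 ^+ 2 - g0 ^+ 2) * c' s + g0 ^+ 2 * (K * (s - s))).
      by ring.
    apply: cvgM; first exact: cvg_cst.
    have g2c : g z ^+ 2 @[z --> (y, s)] --> g0 ^+ 2 by apply: cvgM; exact: gc.
    apply: cvgD; apply: cvgM => //.
    - by apply: cvgB => //; exact: cvg_cst.
    - exact: cvg_cst.
    - by apply: cvgM; [exact: cvg_cst|apply: cvgB => //; exact: cvg_cst].
  - have dc : z.1 - y @[z --> (y, s)] --> y - y.
      by apply: cvgB; [exact: cvg_fst|exact: cvg_cst].
    have -> : 0 = - (k * sig * e ^+ 2 *
                     (4 * dotv y (y - y) + dotv (y - y) (y - y))).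
      by rewrite subrr -(scale0r y) !dotvZr !mul0r; ring.
    apply: cvgN; apply: cvgM; first exact: cvg_cst.
    apply: cvgD; last exact: cvg_dotv.
    apply: cvgM; first exact: cvg_cst.
    by apply: cvg_dotv => //; exact: cvg_cst.
  - apply: filterS touch => z h /h {}h.
    apply: le_trans (_ : - (k * (g z ^+ 2 *
      (sig - c' s * (z.2 - s) - K * (z.2 - s) ^+ 2))) <= _).
      rewrite lerN2; apply: le_trans h; rewrite ler_pM2l //.
      by rewrite ler_wpM2l ?sqr_ge0 //; have := ctay s z.2; rewrite /sig; lra.
    rewrite le_eqVlt; apply/orP; left; apply/eqP.
    have -> : g z = g0 - 2 * e * dotv y (z.1 - y) - e * dotv (z.1 - y) (z.1 - y).
      by rewrite /g0 /g (dotvv_sub z.1 y) /=; ring.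
    rewrite phiE mulNmx Yv -/g0 -/sig; move: (z.1 - y) => v.
    by rewrite !(dotvNl, dotvZl, dotvDl); field.
have [_ /(_ _ _ _ jet)] := sol y s Dys.
rewrite Yv phiE -/g0 -/sig !(dotvNl, dotvZl, dotvDl, dotvZr).
apply/negP; rewrite -ltNge.
have e_lam : 9 * e ^+ 2 < lam by move: lam0; rewrite /lam; lra.
have sigI : 0 < sig <= 1 by rewrite sig0 /= /sig; lra.
have rhoI : 0 <= e * dotv y y < 1.
  by rewrite eR /=; move: gy; rewrite /g /=; lra.
have := separated_subsolution e0 e_lam (c'ge s) sigI rhoI.
have pos : 0 < k ^+ 3 * sig ^+ 2 * g0 ^+ 2.
  by apply: mulr_gt0; [apply: mulr_gt0|]; exact: exprn_gt0.
rewrite -(pmulr_rgt0 _ pos); congr (0 < _).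
by rewrite /g0 /g /=; ring.
Qed.

End MaximumPrinciple.

(** * The two bounds *)

Lemma bounded_above_on (R : realType) (S : Type) (A : set S) (u : S -> R) :
  [bounded u z | z in A] -> exists M, forall z, A z -> u z <= M.
Proof.
move=> [M [_ uM]]; exists (M + 1) => z Az; apply: le_trans (ler_norm _) _.
by apply: uM Az; rewrite ltrDl.
Qed.

Theorem lemma4p1 (R : realType) (n : nat) (n_ge2 : (2 <= n)%N)
    (T : R) (T_gt0 : 0 < T)
    (f : 'cV[R]_n -> R) (f_gt0 : forall x, 0 < f x)
    (f_cont : continuous f) (f_bounded : [bounded f x | x in [set: 'cV[R]_n]])
    (phi : 'cV[R]_n * R -> R)
    (phi_cont : {within cylinder setT T `|` initial_slice setT,
                   continuous phi})
    (phi_gt0 : forall z, (cylinder setT T `|` initial_slice setT) z ->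
                 0 < phi z)
    (phi_sol : viscosity_solution (cylinder setT T) phi)
    (phi_init : forall x, phi (x, 0) = f x)
    (phi_bounded : [bounded phi z | z in cylinder setT T `|`
                                         initial_slice setT]) :
  forall (x : 'cV[R]_n) (t : R), cylinder setT T (x, t) ->
    inf (range f) <= phi (x, t) <= sup (range f).
Proof.
move=> x t xt; apply/andP; split.
  apply: (min_principle phi_cont phi_sol phi_gt0) xt => {}x.
  rewrite phi_init; apply: ge_inf; last by exists x.
  by exists 0 => _ [v _ <-]; exact: ltW.
have [M phiM] := bounded_above_on phi_bounded.
have [L fL] := bounded_above_on f_bounded.
have f_sup : has_sup (range f).
  split; first by exists (f 0), 0.
  by exists L => _ [v _ <-]; exact: fL.
have f_le v : f v <= sup (range f).
  by apply: sup_upper_bound => //; exists v.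
apply: (max_principle (M := M) phi_cont phi_sol) xt.
- exact: lt_le_trans (f_gt0 0) (f_le 0).
- exact: phiM.
- by move=> v; rewrite phi_init.
Qed.
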